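(* Let $k\in\{\mathbb{R},\mathbb{C}\}$ be fixed. The following categories of vector spaces over $k$, each furnished with the linear and continuous maps as morphisms, are quasi-abelian and integral: (i) the category $\mathsf{SNOR}$ of semi-normed spaces; (ii) the category $\mathsf{LCS}$ of (Hausdorff and non-Hausdorff) locally convex spaces; (iii) the category $\mathsf{TVS}$ of (Hausdorff and non-Hausdorff) topological vector spaces.
   Context: A topological vector space is a pair $(X,\tau)$ where $X$ is a $k$-vector space and $\tau$ is a topology (not assumed Hausdorff) making the vector space operations continuous; it is locally convex if $0$ has a basis of convex neighbourhoods. A semi-normed space is a $k$-vector space with a semi-norm, endowed with the induced topology. An additive category is pre-abelian if every morphism has a kernel and a cokernel. A morphism is called ''a kernel'' (resp. ''a cokernel'') if it is the kernel (resp. cokernel) of some morphism. A class $\mathcal{X}$ of morphisms is stable under pullback if in any pullback square with $a\colon A\to B$, $b\colon A\to C$, $c\colon B\to D$, $d\colon C\to D$ and $c\circ a=d\circ b$, one has $a\in\mathcal{X}$ whenever $d\in\mathcal{X}$; stability under pushout is defined dually. A pre-abelian category is left quasi-abelian if cokernels are stable under pullback, right quasi-abelian if kernels are stable under pushout, and quasi-abelian if it is both. A pre-abelian category is left integral if epimorphisms are stable under pullback, right integral if monomorphisms are stable under pushout, and integral if it is both. *)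

(* Defs.v *)
From HB Require Import structures.
From mathcomp Require Import all_boot all_order all_algebra.
From mathcomp Require Import all_classical all_reals all_analysis.
From mathcomp Require Import complex.

Set Implicit Arguments.
Unset Strict Implicit.
Unset Printing Implicit Defensive.

Import Order.TTheory GRing.Theory Num.Theory.
Import numFieldNormedType.Exports.

Local Open Scope classical_set_scope.
Local Open Scope ring_scope.

Declare Scope cat_scope.
Delimit Scope cat_scope with cat.

(* The additive structure on the morphism groups is data here; "additive", in
   the sense of having a zero object and binary biproducts, is the predicate
   [additive_category] below. *)
Record preadditive := Preadditive {
  obj :> Type;
  mor : obj -> obj -> zmodType;
  idm : forall A, mor A A;
  compm : forall A B C, mor B C -> mor A B -> mor A C;
  compm_idr : forall A B (f : mor A B), compm f (idm A) = f;
  compm_idl : forall A B (f : mor A B), compm (idm B) f = f;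
  compmA : forall A B C D (h : mor C D) (g : mor B C) (f : mor A B),
    compm h (compm g f) = compm (compm h g) f;
  compmDl : forall A B C (g g' : mor B C) (f : mor A B),
    compm (g + g') f = compm g f + compm g' f;
  compmDr : forall A B C (g : mor B C) (f f' : mor A B),
    compm g (f + f') = compm g f + compm g f'
}.

Arguments mor {p} A B.
Arguments idm {p} A.
Arguments compm {p A B C} g f.

Notation "g ∘ f" := (compm g f) (at level 40, left associativity) : cat_scope.
Local Open Scope cat_scope.

Section Notions.
Variable C : preadditive.

Definition monomorphism (A B : C) (f : mor A B) :=
  forall (T : C) (u v : mor T A), f ∘ u = f ∘ v -> u = v.

Definition epimorphism (A B : C) (f : mor A B) :=
  forall (T : C) (u v : mor B T), u ∘ f = v ∘ f -> u = v.

Definition is_kernel_of (A B K : C) (f : mor A B) (k : mor K A) :=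
  f ∘ k = 0 /\
  forall (T : C) (t : mor T A), f ∘ t = 0 -> exists! u : mor T K, k ∘ u = t.

Definition is_cokernel_of (A B Q : C) (f : mor A B) (q : mor B Q) :=
  q ∘ f = 0 /\
  forall (T : C) (t : mor B T), t ∘ f = 0 -> exists! u : mor Q T, u ∘ q = t.

Definition is_kernel (K A : C) (k : mor K A) :=
  exists (B : C) (f : mor A B), is_kernel_of f k.

Definition is_cokernel (B Q : C) (q : mor B Q) :=
  exists (A : C) (f : mor A B), is_cokernel_of f q.

(* In the next two definitions the square is
       A --a--> B
       |b       |c
       v        v
       C' -d--> D                                                            *)
Definition is_pullback (A B C' D : C)
    (a : mor A B) (b : mor A C') (c : mor B D) (d : mor C' D) :=
  c ∘ a = d ∘ b /\
  forall (T : C) (s : mor T B) (t : mor T C'), c ∘ s = d ∘ t ->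
    exists! u : mor T A, a ∘ u = s /\ b ∘ u = t.

Definition is_pushout (A B C' D : C)
    (a : mor A B) (b : mor A C') (c : mor B D) (d : mor C' D) :=
  c ∘ a = d ∘ b /\
  forall (T : C) (s : mor B T) (t : mor C' T), s ∘ a = t ∘ b ->
    exists! u : mor D T, u ∘ c = s /\ u ∘ d = t.

Definition stable_under_pullback (P : forall A B : C, mor A B -> Prop) :=
  forall (A B C' D : C)
    (a : mor A B) (b : mor A C') (c : mor B D) (d : mor C' D),
    is_pullback a b c d -> P _ _ d -> P _ _ a.

Definition stable_under_pushout (P : forall A B : C, mor A B -> Prop) :=
  forall (A B C' D : C)
    (a : mor A B) (b : mor A C') (c : mor B D) (d : mor C' D),
    is_pushout a b c d -> P _ _ a -> P _ _ d.

Definition is_zero_object (Z : C) :=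
  forall A : C, (exists! f : mor Z A, True) /\ (exists! f : mor A Z, True).

Definition is_biproduct (A B P : C)
    (iA : mor A P) (iB : mor B P) (pA : mor P A) (pB : mor P B) :=
  [/\ pA ∘ iA = idm A, pB ∘ iB = idm B, pA ∘ iB = 0, pB ∘ iA = 0 &
      iA ∘ pA + iB ∘ pB = idm P].

Definition additive_category :=
  (exists Z : C, is_zero_object Z) /\
  (forall A B : C, exists (P : C)
     (iA : mor A P) (iB : mor B P) (pA : mor P A) (pB : mor P B),
     is_biproduct iA iB pA pB).

Definition pre_abelian :=
  [/\ additive_category,
      forall (A B : C) (f : mor A B),
        exists (K : C) (k : mor K A), is_kernel_of f k &
      forall (A B : C) (f : mor A B),
        exists (Q : C) (q : mor B Q), is_cokernel_of f q].

Definition left_quasi_abelian :=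
  pre_abelian /\ stable_under_pullback is_cokernel.

Definition right_quasi_abelian :=
  pre_abelian /\ stable_under_pushout is_kernel.

Definition quasi_abelian := left_quasi_abelian /\ right_quasi_abelian.

Definition left_integral :=
  pre_abelian /\ stable_under_pullback epimorphism.

Definition right_integral :=
  pre_abelian /\ stable_under_pushout monomorphism.

Definition integral_category := left_integral /\ right_integral.

End Notions.

#[short(type="linearContinuousType")]
HB.structure Definition LinearContinuous (K : numDomainType)
    (X Y : topologicalLmodType K) :=
  {f of @isContinuous X Y f & @GRing.Linear K X Y *:%R f}.

Section LinearContinuousZmodule.
Variables (K : numDomainType) (X Y : topologicalLmodType K).
Implicit Types f g h : linearContinuousType X Y.

(* Morphisms are compared by Leibniz equality, which is equality of the
   underlying maps. *)
Lemma linearContinuousP f g : (f : X -> Y) = g -> f = g.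
Proof.
case: f => f [[cf] [af] [lf]]; case: g => g [[cg] [ag] [lg]] /= efg.
subst g; congr LinearContinuous.Pack.
by congr LinearContinuous.Class; congr (_ _); apply: Prop_irrelevance.
Qed.

HB.instance Definition _ := gen_eqMixin (linearContinuousType X Y).
HB.instance Definition _ := gen_choiceMixin (linearContinuousType X Y).

Lemma lc_zero_continuous : continuous (\0 : X -> Y).
Proof. by move=> x; exact: cvg_cst. Qed.
HB.instance Definition _ := isContinuous.Build X Y (\0 : X -> Y)
  lc_zero_continuous.

Lemma lc_opp_continuous f : continuous (\- f : X -> Y).
Proof.
move=> x; apply: (@continuous_comp _ _ _ f -%R); first exact: cts_fun.
exact: opp_continuous.
Qed.
HB.instance Definition _ f := isContinuous.Build X Y (\- f) (@lc_opp_continuous f).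

Lemma lc_add_continuous f g : continuous (f \+ g : X -> Y).
Proof.
move=> x.
apply: (@continuous_comp _ _ _ (fun x => (f x, g x)) (fun y : Y * Y => y.1 + y.2)).
  by apply: cvg_pair; exact: cts_fun.
exact: add_continuous.
Qed.
HB.instance Definition _ f g := isContinuous.Build X Y (f \+ g)
  (@lc_add_continuous f g).

Let lc0 : linearContinuousType X Y := \0.
Let lcN f : linearContinuousType X Y := \- f.
Let lcD f g : linearContinuousType X Y := f \+ g.

Let lcDA : associative lcD.
Proof. by move=> f g h; apply/linearContinuousP/funext => x; exact: addrA. Qed.
Let lcDC : commutative lcD.
Proof. by move=> f g; apply/linearContinuousP/funext => x; exact: addrC. Qed.
Let lc0D : left_id lc0 lcD.
Proof. by move=> f; apply/linearContinuousP/funext => x; exact: add0r. Qed.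
Let lcND : left_inverse lc0 lcN lcD.
Proof. by move=> f; apply/linearContinuousP/funext => x; exact: addNr. Qed.

HB.instance Definition _ := GRing.isZmodule.Build (linearContinuousType X Y)
  lcDA lcDC lc0D lcND.

End LinearContinuousZmodule.

Section LinearContinuousComp.
Variable K : numDomainType.
Implicit Types X Y Z : topologicalLmodType K.

Lemma lc_id_continuous X : continuous (idfun : X -> X).
Proof. by move=> x; exact: cvg_id. Qed.
HB.instance Definition _ X := isContinuous.Build X X idfun
  (@lc_id_continuous X).

Lemma lc_comp_continuous X Y Z
  (g : linearContinuousType Y Z) (f : linearContinuousType X Y) :
  continuous (g \o f).
Proof. by move=> x; apply: continuous_comp; exact: cts_fun. Qed.
HB.instance Definition _ X Y Z
    (g : linearContinuousType Y Z) (f : linearContinuousType X Y) :=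
  isContinuous.Build X Z (g \o f) (@lc_comp_continuous X Y Z g f).

Definition lc_id X : linearContinuousType X X := idfun.
Definition lc_comp X Y Z
    (g : linearContinuousType Y Z) (f : linearContinuousType X Y) :
  linearContinuousType X Z := g \o f.

End LinearContinuousComp.

(* Objects are the elements of [I], seen as topological vector spaces through
   [T], which need not be injective: it forgets the choice of the semi-norm in
   the case of semi-normed spaces. *)
Program Definition linear_continuous_category (K : numDomainType) (I : Type)
    (T : I -> topologicalLmodType K) : preadditive :=
  @Preadditive I (fun i j => linearContinuousType (T i) (T j))
    (fun i => lc_id (T i)) (fun i j l g f => lc_comp g f) _ _ _ _ _.
Next Obligation. by move=> *; exact/linearContinuousP. Qed.
Next Obligation. by move=> *; exact/linearContinuousP. Qed.
Next Obligation. by move=> *; exact/linearContinuousP. Qed.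
Next Obligation. by move=> *; exact/linearContinuousP. Qed.
Next Obligation.
by move=> *; apply/linearContinuousP/funext => x /=; exact: raddfD.
Qed.

(* [topologicalLmodType K] has no separation axiom, and its scalar
   multiplication is jointly continuous for the norm topology of [K]. *)
Definition TVS (K : numFieldType) : preadditive :=
  @linear_continuous_category K (topologicalLmodType K) id.

(* The weights in [convex_set] are the l with 0 <= l <= 1 in [K]; over the complex
   numbers, whose order is partial, these are the real l in [0, 1].
   The library's [tvsType] is not used for locally convex spaces because it
   carries a chosen uniform structure besides its topology. *)
Definition locally_convex_at0 (K : numFieldType) (X : topologicalLmodType K) :=
  forall U : set X, nbhs 0 U ->
    exists V : set X, [/\ nbhs 0 V, convex_set V & V `<=` U].

Record lcs (K : numFieldType) := Lcs {
  lcs_tvs :> topologicalLmodType K;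
  lcs_locally_convex : locally_convex_at0 lcs_tvs }.

Definition LCS (K : numFieldType) : preadditive :=
  linear_continuous_category (@lcs_tvs K).

(* As with norms in MathComp, a semi-norm takes its values in [K]; they are
   nonnegative elements of [K], hence real also when [K] is complex. *)
Record semiNormedSpace (K : numFieldType) := SemiNormedSpace {
  sns_lmod :> lmodType K;
  seminorm : sns_lmod -> K;
  seminorm_ge0 : forall x, 0 <= seminorm x;
  seminormD : forall x y, seminorm (x + y) <= seminorm x + seminorm y;
  seminormZ : forall a x, seminorm (a *: x) = `|a| * seminorm x }.

(* The vector space [V] with the topology induced by its semi-norm. *)
Definition seminorm_topology (K : numFieldType) (V : semiNormedSpace K) : Type :=
  V.

Section SeminormTopology.
Variables (K : numFieldType) (V : semiNormedSpace K).
Local Notation X := (seminorm_topology V).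
Local Notation p := (@seminorm K V).

HB.instance Definition _ := GRing.Lmodule.on X.

Let seminormMn (x : X) n : p (x *+ n) = p x *+ n.
Proof. by rewrite -scaler_nat seminormZ normr_nat mulr_natl. Qed.

Let seminormN (x : X) : p (- x) = p x.
Proof. by rewrite -scaleN1r seminormZ normrN1 mul1r. Qed.

HB.instance Definition _ := Num.Zmodule_isSemiNormed.Build K X
  (@seminormD K V) seminormMn seminormN.

Lemma seminorm_normrZ (a : K) (x : X) : `|a *: x| = `|a| * `|x|.
Proof. exact: seminormZ. Qed.

HB.instance Definition _ := hasNbhs.Build X
  (nbhs_ball_ (ball_ p)).

Lemma seminorm_nbhsP (x : X) (A : set X) :
  nbhs x A <-> exists2 e : K, 0 < e & forall y : X, `|x - y| < e -> A y.
Proof. by split => -[e e0 eA]; exists e. Qed.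

Let nbhs_filter (x : X) : ProperFilter (nbhs x).
Proof.
split.
  by move=> /seminorm_nbhsP[e e0] /(_ x); apply; rewrite subrr normr0.
split=> [|P Q|P Q PQ].
- by apply/seminorm_nbhsP; exists 1.
- move=> /seminorm_nbhsP[e e0 eP] /seminorm_nbhsP[f f0 fQ].
  apply/seminorm_nbhsP; exists (Num.min e f); first by rewrite /Num.min; case: ifP.
  have ef : (e >=< f)%R by apply: real_comparable; exact: gtr0_real.
  move=> y; rewrite comparable_lt_min// => /andP[ye yf].
  by split; [exact: eP|exact: fQ].
- move=> /seminorm_nbhsP[e e0 eP]; apply/seminorm_nbhsP.
  by exists e => // y /eP/PQ.
Qed.

Let nbhs_singleton (x : X) (A : set X) : nbhs x A -> A x.
Proof. by move=> /seminorm_nbhsP[e e0]; apply; rewrite subrr normr0. Qed.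

Let nbhs_nbhs (x : X) (A : set X) : nbhs x A -> nbhs x (nbhs^~ A).
Proof.
move=> /seminorm_nbhsP[e e0 eA]; apply/seminorm_nbhsP; exists e => // y xy.
apply/seminorm_nbhsP; exists (e - `|x - y|); first by rewrite subr_gt0.
move=> z; rewrite ltrBrDl => yz; apply: eA.
by rewrite -(subrK y x) -addrA (le_lt_trans (ler_normD _ _)).
Qed.

HB.instance Definition _ :=
  Nbhs_isNbhsTopological.Build X nbhs_filter nbhs_singleton nbhs_nbhs.

Let seminorm_add_continuous : continuous (fun x : X * X => x.1 + x.2).
Proof.
move=> [x y] A /seminorm_nbhsP[e e0 eA].
have h : 0 < e / 2 by rewrite divr_gt0.
exists ([set z | `|x - z| < e / 2], [set z | `|y - z| < e / 2]).
  by split; apply/seminorm_nbhsP; exists (e / 2).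
move=> [a b] [/= xa yb]; apply: eA => /=.
by rewrite opprD addrACA (le_lt_trans (ler_normD _ _))// [ltRHS]splitr ltrD.
Qed.

Let seminorm_scale_continuous : continuous (fun z : K^o * X => z.1 *: z.2).
Proof.
move=> [k x] A /seminorm_nbhsP[e e0 eA] /=.
have h : 0 < e / 2 by rewrite divr_gt0.
have x1 : 0 < `|x| + 1 by rewrite ltr_wpDl.
have k1 : 0 < `|k| + 1 by rewrite ltr_wpDl.
pose d := e / 2 / (`|x| + 1).
have d0 : 0 < d by rewrite divr_gt0.
have kd : 0 < `|k| + d by rewrite ltr_wpDl.
pose r := e / 2 / (`|k| + d).
have r0 : 0 < r by rewrite divr_gt0.
exists ([set l : K^o | `|k - l| < d], [set z : X | `|x - z| < r]).
  split; first by exists d.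
  by apply/seminorm_nbhsP; exists r.
move=> [l z] [/= kl xz]; apply: eA => /=.
have -> : k *: x - l *: z = (k - l) *: x + l *: (x - z).
  by rewrite scalerBl scalerBr addrA subrK.
rewrite (le_lt_trans (ler_normD _ _))// [ltRHS]splitr !seminorm_normrZ.
apply: ltr_leD.
  have [x0|x0] := eqVneq `|x| 0; first by rewrite x0 mulr0.
  rewrite (@lt_trans _ _ (d * `|x|))// ?ltr_pM2r// ?lt0r ?x0//=.
  by rewrite /d mulrAC -mulrA gtr_pMr// ltr_pdivrMr// mul1r ltrDl.
have lkd : `|l| <= `|k| + d.
  rewrite -(subrK k l) addrC (le_trans (ler_normD _ _))// lerD2l distrC.
  exact: ltW.
have -> : e / 2 = (`|k| + d) * r by rewrite [RHS]mulrC divfK ?gt_eqF.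
by rewrite ler_pM// ltW.
Qed.

HB.instance Definition _ :=
  PreTopologicalNmodule_isTopologicalNmodule.Build X seminorm_add_continuous.
HB.instance Definition _ :=
  TopologicalNmodule_isTopologicalLmodule.Build K X seminorm_scale_continuous.

End SeminormTopology.

Definition SNOR (K : numFieldType) : preadditive :=
  @linear_continuous_category K (semiNormedSpace K)
    (fun V => seminorm_topology V : topologicalLmodType K).

(* Main.v *)
(* In each of the three categories, the vector space structure and the topology can
   be transported to subspaces, products (initial topologies) and quotients (final
   topologies); for semi-normed spaces the quotient carries the infimum semi-norm,
   which is where the completeness of R is used. Hence monomorphisms are the injective
   maps, epimorphisms the surjective ones (quotients need not be Hausdorff), kernels
   the topological embeddings and cokernels the open surjections. Comparing an
   arbitrary pullback with a kernel in B x C' and an arbitrary pushout with a quotient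
   of B x C', the four stability properties become statements about neighbourhoods
   of 0. *)
From HB Require Import structures.
Require Import Defs.
From mathcomp Require Import all_boot all_order all_algebra.
From mathcomp Require Import all_classical all_reals all_analysis.
From mathcomp Require Import complex.

Set Implicit Arguments.
Unset Strict Implicit.
Unset Printing Implicit Defensive.

Import Order.TTheory GRing.Theory Num.Theory.
Import numFieldNormedType.Exports.

Local Open Scope classical_set_scope.
Local Open Scope ring_scope.
Local Open Scope cat_scope.

(** * Submodules and quotient modules *)

Section LinearKernelRange.
Variables (K : numFieldType) (V W : lmodType K) (f : {linear V -> W}).

Definition linear_kernel (x : V) := f x == 0.

Lemma linear_kernel_submod : submod_closed linear_kernel.
Proof.
split=> [|a x y /eqP fx /eqP fy]; apply/eqP; first by rewrite raddf0.
by rewrite linearP fx fy scaler0 addr0.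
Qed.

Definition linear_kernel_submodClosed : submodClosed V := HB.pack linear_kernel
  (GRing.isSubmodClosed.Build K V linear_kernel linear_kernel_submod).

(** The classical truth value makes the range a boolean predicate, as [submodClosed] requires. *)
Definition linear_range (y : W) := `[< exists x, f x = y >].

Lemma linear_range_submod : submod_closed linear_range.
Proof.
split=> [|a _ _ /asboolP[x <-] /asboolP[y <-]].
  by apply/asboolP; exists 0; rewrite raddf0.
by apply/asboolP; exists (a *: x + y); rewrite linearP.
Qed.

Definition linear_range_submodClosed : submodClosed W := HB.pack linear_range
  (GRing.isSubmodClosed.Build K W linear_range linear_range_submod).

End LinearKernelRange.

Section Submodule.
Variables (K : numFieldType) (V : lmodType K) (S : submodClosed V).

Record submodule := Submodule { submodule_val :> V; _ : submodule_val \in S }.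

HB.instance Definition _ := [isSub for submodule_val].
HB.instance Definition _ := [Choice of submodule by <:].
HB.instance Definition _ := [SubChoice_isSubLmodule of submodule by <:].

Lemma submodule_val_linear : linear submodule_val.
Proof. by []. Qed.
HB.instance Definition _ := GRing.isLinear.Build K submodule V *:%R submodule_val
  submodule_val_linear.

End Submodule.

Section QuotientModule.
Variables (K : numFieldType) (V : lmodType K) (S : submodClosed V).
Local Open Scope quotient_scope.

Lemma submodClosed_zmod : zmod_closed S.
Proof.
split=> [|x y Sx Sy]; first exact: rpred0.
by rewrite -scaleN1r rpredD// rpredZ.
Qed.

Let S_zmod : zmodClosed V := HB.pack (GRing.SubmodClosed.sort S)
  (GRing.isZmodClosed.Build V (GRing.SubmodClosed.sort S) submodClosed_zmod).
Local Notation zmod_quotient := (Quotient.quot S_zmod).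

Definition quotient_module : Type := zmod_quotient.
HB.instance Definition _ := GRing.Zmodule.on quotient_module.

Definition quotient_proj (x : V) : quotient_module := \pi_zmod_quotient x.

Lemma quotient_proj_surj (z : quotient_module) : exists x, quotient_proj x = z.
Proof. by exists (repr (z : zmod_quotient)); exact: reprK. Qed.

Lemma quotient_projD x y : quotient_proj (x + y) = quotient_proj x + quotient_proj y.
Proof. exact: (raddfD \pi_zmod_quotient). Qed.

Lemma quotient_proj_eq x y : (quotient_proj x = quotient_proj y) <-> (x - y \in S).
Proof.
have E : (x - y \in S) = (x == y %[mod zmod_quotient]) := Quotient.idealrBE S_zmod x y.
by rewrite E; split=> /eqP.
Qed.

(** Scales a chosen representative; [quotient_projZ] shows that the choice does not matter, so the
    module laws descend from [V]. *)
Definition quotient_scale (a : K) (z : quotient_module) : quotient_module :=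
  quotient_proj (a *: repr (z : zmod_quotient)).

Lemma quotient_projZ a x : quotient_proj (a *: x) = quotient_scale a (quotient_proj x).
Proof.
apply/quotient_proj_eq; rewrite -scalerBr rpredZ//.
by apply/quotient_proj_eq; exact/esym/reprK.
Qed.

Fact quotient_scaleA a b z :
  quotient_scale a (quotient_scale b z) = quotient_scale (a * b) z.
Proof.
by have [x <-] := quotient_proj_surj z; rewrite -!quotient_projZ scalerA.
Qed.

Fact quotient_scale1 : left_id 1 quotient_scale.
Proof.
by move=> z; have [x <-] := quotient_proj_surj z; rewrite -quotient_projZ scale1r.
Qed.

Fact quotient_scaleDr : right_distributive quotient_scale +%R.
Proof.
move=> a z w; have [x <-] := quotient_proj_surj z.
have [y <-] := quotient_proj_surj w.
by rewrite -quotient_projD -!quotient_projZ -quotient_projD scalerDr.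
Qed.

Fact quotient_scaleDl z : {morph quotient_scale^~ z : a b / a + b}.
Proof.
move=> a b; have [x <-] := quotient_proj_surj z.
by rewrite -!quotient_projZ -quotient_projD scalerDl.
Qed.

HB.instance Definition _ := GRing.Zmodule_isLmodule.Build K quotient_module
  quotient_scaleA quotient_scale1 quotient_scaleDr quotient_scaleDl.

Lemma quotient_proj_linear : linear quotient_proj.
Proof. by move=> a x y; rewrite quotient_projD quotient_projZ. Qed.
HB.instance Definition _ := GRing.isLinear.Build K V quotient_module *:%R quotient_proj
  quotient_proj_linear.

Lemma quotient_proj_eq0 x : (quotient_proj x = 0) <-> (x \in S).
Proof. by rewrite -(raddf0 quotient_proj) quotient_proj_eq subr0. Qed.

End QuotientModule.

(** * Vector space topologies from neighbourhoods of 0 *)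

Section TopologicalLmoduleNbhs0.
Variables (K : numFieldType) (X : topologicalLmodType K).
Implicit Types (x y : X) (U : set X).

Lemma nbhs_translate x y U : nbhs (x + y) U -> nbhs y [set v | U (x + v)].
Proof.
move=> /(@add_continuous X (x, y))[[P Q] [/= Px Qy] PQ].
apply: filterS Qy => v Qv; apply: (PQ (x, v)).
by split=> //=; exact: nbhs_singleton.
Qed.

Lemma nbhs_translate0 x U : nbhs x U <-> nbhs 0 [set v | U (x + v)].
Proof.
split=> [Ux|U0]; first by apply: nbhs_translate; rewrite addr0.
have : nbhs (- x + x) [set v | U (x + v)] by rewrite addNr.
by move/nbhs_translate; apply: filterS => v /=; rewrite addNKr.
Qed.

Lemma nbhs0D U : nbhs 0 U ->
  exists2 W, nbhs 0 W & forall x y, W x -> W y -> U (x + y).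
Proof.
have := @add_continuous X (0, 0) U; rewrite /= addr0 => /[apply].
move=> [[P Q] [/= P0 Q0] PQ]; exists (P `&` Q); first exact: filterI.
by move=> x y [Px _] [_ Qy]; exact: (PQ (x, y)).
Qed.

(** This is joint continuity of scaling at [(a, x)], recentred at 0. For [a = 0] it contains the
    absorption of [x] by [U]. *)
Lemma nbhs0Z U (a : K) x : nbhs 0 U ->
  exists (e : K) W, [/\ 0 < e, nbhs 0 W &
    forall (l : K) v, `|a - l| < e -> W v -> U (l *: (x + v) - a *: x)].
Proof.
move=> U0; have := @scale_continuous K X (a, x) [set y | U (y - a *: x)].
have Uax : nbhs (a *: x) [set y | U (y - a *: x)].
  apply/nbhs_translate0; apply: filterS U0 => v Uv /=.
  by rewrite addrAC subrr add0r.
move=> /(_ Uax)[[P Q] [/= [e /= e0 eP] /nbhs_translate0 Qx] PQ].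
exists e, [set v | Q (x + v)]; split=> // l v le Qv.
by apply: (PQ (l, x + v)); split=> //=; exact: eP.
Qed.

End TopologicalLmoduleNbhs0.

(** The axioms of a neighbourhood filter of 0 for a vector space topology; the other neighbourhoods
    are its translates. Stating continuity of scaling at every [(a, x)] replaces balanced and
    absorbing sets. *)
Record zero_filter (K : numFieldType) (V : lmodType K) := ZeroFilter {
  zero_nbhs : set_system V;
  zero_nbhs_filter : Filter zero_nbhs;
  zero_nbhs0 : forall U, zero_nbhs U -> U 0;
  zero_nbhsD : forall U, zero_nbhs U ->
    exists2 W, zero_nbhs W & forall x y, W x -> W y -> U (x + y);
  zero_nbhsZ : forall U (a : K) x, zero_nbhs U ->
    exists (e : K) W, [/\ 0 < e, zero_nbhs W &
      forall (l : K) v, `|a - l| < e -> W v -> U (l *: (x + v) - a *: x)] }.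

(** An alias of [V] indexed by [F], so that one vector space can carry several topologies. *)
Definition zero_filter_space (K : numFieldType) (V : lmodType K)
  (F : zero_filter V) : Type := V.

Section ZeroFilterSpace.
Variables (K : numFieldType) (V : lmodType K) (F : zero_filter V).
Local Notation X := (zero_filter_space F).

HB.instance Definition _ := GRing.Lmodule.on X.

HB.instance Definition _ := hasNbhs.Build X
  (fun x => [set U : set X | zero_nbhs F [set v | U (x + v)]]).

Lemma zero_filter_nbhsP (x : X) (U : set X) :
  nbhs x U <-> zero_nbhs F [set v | U (x + v)].
Proof. by []. Qed.

Lemma zero_filter_nbhs_shift (x : X) (W : set X) :
  zero_nbhs F W -> nbhs x [set y | W (y - x)].
Proof.
move=> FW; apply/zero_filter_nbhsP; apply: (@filterS _ _ (zero_nbhs_filter F)) FW.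
by move=> v /=; rewrite addrAC subrr add0r.
Qed.

Let nbhs_filter (x : X) : ProperFilter (nbhs x).
Proof.
have FF := zero_nbhs_filter F.
split; first by move=> /zero_filter_nbhsP /zero_nbhs0.
split=> [|P Q /zero_filter_nbhsP xP /zero_filter_nbhsP xQ|P Q PQ].
- by apply/zero_filter_nbhsP; exact: filterT.
- by apply/zero_filter_nbhsP; exact: filterI xP xQ.
- by move=> /zero_filter_nbhsP xP; apply/zero_filter_nbhsP; apply: filterS xP => v /PQ.
Qed.

Let nbhs_singleton (x : X) (A : set X) : nbhs x A -> A x.
Proof. by move=> /zero_filter_nbhsP /zero_nbhs0 /=; rewrite addr0. Qed.

Let nbhs_nbhs (x : X) (A : set X) : nbhs x A -> nbhs x (nbhs^~ A).
Proof.
have FF := zero_nbhs_filter F.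
(* Since [W + W] lies in the translate of [A] to 0, [A] is a neighbourhood of each point of
   [x + W]. *)
move=> /zero_filter_nbhsP /zero_nbhsD[W FW WA].
apply/zero_filter_nbhsP; apply: filterS (FW) => v Wv.
apply/zero_filter_nbhsP; apply: filterS FW => w Ww /=.
by rewrite -addrA; exact: WA.
Qed.

HB.instance Definition _ :=
  Nbhs_isNbhsTopological.Build X nbhs_filter nbhs_singleton nbhs_nbhs.

Let zf_add_continuous : continuous (fun x : X * X => x.1 + x.2).
Proof.
move=> [x y] A /zero_filter_nbhsP /zero_nbhsD[W FW WA].
exists ([set u | W (u - x)], [set v | W (v - y)]).
  by split; exact: zero_filter_nbhs_shift.
move=> [u v] [/= Wu Wv]; have := WA _ _ Wu Wv.
by rewrite /= addrACA !subrKC.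
Qed.

Let zf_scale_continuous : continuous (fun z : K^o * X => z.1 *: z.2).
Proof.
move=> [a x] A /zero_filter_nbhsP FA.
have [e [W [e0 FW WA]]] := @zero_nbhsZ K V F _ a x FA.
exists ([set l : K^o | `|a - l| < e], [set v | W (v - x)]).
  by split; [exists e|exact: zero_filter_nbhs_shift].
move=> [l v] [/= al Wv]; have := WA _ _ al Wv.
by rewrite /= !subrKC.
Qed.

HB.instance Definition _ :=
  PreTopologicalNmodule_isTopologicalNmodule.Build X zf_add_continuous.
HB.instance Definition _ :=
  TopologicalNmodule_isTopologicalLmodule.Build K X zf_scale_continuous.

Lemma zero_filter_nbhs0 (U : set X) : nbhs (0 : X) U <-> zero_nbhs F U.
Proof.
split; [move=> /zero_filter_nbhsP|move=> FU; apply/zero_filter_nbhsP].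
  by apply: (@filterS _ _ (zero_nbhs_filter F)) => v /=; rewrite add0r.
by apply: (@filterS _ _ (zero_nbhs_filter F)) FU => v /=; rewrite add0r.
Qed.

End ZeroFilterSpace.

Section ZeroFilterExamples.
Variables (K : numFieldType) (V : lmodType K).

(** Provides one object of [TVS] and of [LCS], from which the zero object is built. *)
Definition indiscrete_filter : zero_filter V.
Proof.
refine (@ZeroFilter K V [set setT] _ _ _ _).
- by move=> U ->.
- by move=> U ->; exists setT.
- by move=> U a x ->; exists 1, setT; split=> //; exact: ltr01.
Defined.

Section Initial.
Variables (X Y : topologicalLmodType K).
Variables (f : {linear V -> X}) (g : {linear V -> Y}).

(** Two maps serve both purposes: with [f = g] an inclusion this is the subspace topology, with two
    projections the product topology. *)
Definition initial_filter : zero_filter V.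
Proof.
refine (@ZeroFilter K V [set U | exists A B,
  [/\ nbhs 0 A, nbhs 0 B & f @^-1` A `&` g @^-1` B `<=` U]] _ _ _ _).
- apply: Build_Filter => [|P Q|P Q PQ].
  + by exists setT, setT; split=> //; exact: filterT.
  + move=> [A [B [A0 B0 AB]]] [C [D [C0 D0 CD]]].
    exists (A `&` C), (B `&` D); split; [exact: filterI|exact: filterI|].
    by move=> x [[Ax Cx] [Bx Dx]]; split; [exact: AB|exact: CD].
  + move=> [A [B [A0 B0 AB]]]; exists A, B; split=> //.
    exact: subset_trans AB PQ.
- move=> U [A [B [A0 B0 AB]]].
  by apply: AB; split; rewrite /preimage/= raddf0; exact: nbhs_singleton.
- move=> U [A [B [/nbhs0D[A' A'0 AA] /nbhs0D[B' B'0 BB] AB]]].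
  exists (f @^-1` A' `&` g @^-1` B'); first by exists A', B'; split.
  move=> x y [Ax Bx] [Ay By]; apply: AB.
  by split; rewrite /preimage/= raddfD; [exact: AA|exact: BB].
- move=> U a x [A [B [A0 B0 AB]]].
  have [e [A' [e0 A'0 AA]]] := nbhs0Z a (f x) A0.
  have [d [B' [d0 B'0 BB]]] := nbhs0Z a (g x) B0.
  (* The order of [K] is partial, but positive elements are real and hence comparable, so the
     minimum of the two radii is meaningful. *)
  have ed : (e >=< d)%R by apply: real_comparable; exact: gtr0_real.
  exists (Num.min e d), (f @^-1` A' `&` g @^-1` B'); split.
  + by rewrite /Num.min; case: ifP.
  + by exists A', B'; split.
  move=> l v; rewrite comparable_lt_min// => /andP[le ld] [Av Bv]; apply: AB.
  split; rewrite /preimage/= raddfB/=.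
  + by rewrite (linearZZ f l) (linearZZ f a) raddfD; exact: AA.
  + by rewrite (linearZZ g l) (linearZZ g a) raddfD; exact: BB.
Defined.

End Initial.

Section Final.
Variables (X : topologicalLmodType K) (q : {linear X -> V}).
Hypothesis q_surj : forall z, exists x, q x = z.

Definition final_filter : zero_filter V.
Proof.
refine (@ZeroFilter K V [set U | nbhs (0 : X) (q @^-1` U)] _ _ _ _).
- by move=> U U0; rewrite -(raddf0 q); exact: (nbhs_singleton U0).
- move=> U /nbhs0D[W W0 WU]; exists (q @` W).
    by apply: filterS W0 => x Wx; exists x.
  by move=> _ _ [x Wx <-] [y Wy <-]; rewrite -raddfD; exact: WU.
- move=> U a x U0; have [y <-] := q_surj x.
  have [e [W [e0 W0 WU]]] := nbhs0Z a y U0.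
  exists e, (q @` W); split=> //; first by apply: filterS W0 => z Wz; exists z.
  move=> l _ al [v Wv <-].
  by rewrite -raddfD -(linearZZ q l) -(linearZZ q a) -raddfB; exact: WU.
Defined.

End Final.

End ZeroFilterExamples.

(** * Exactness from subspaces, quotients and biproducts *)

Section LinearContinuousMaps.
Variable K : numFieldType.
Implicit Types X Y Z : topologicalLmodType K.

(** For linear continuous maps, translation spreads a condition at 0 to all points: this is a
    topological embedding, and [open_surjection] below an open surjective map. *)
Definition embedding X Y (k : X -> Y) := injective k /\
  forall U, nbhs (0 : X) U -> exists2 W, nbhs (0 : Y) W & forall x, W (k x) -> U x.

Definition open_surjection X Y (q : X -> Y) := (forall y, exists x, q x = y) /\
  forall U, nbhs (0 : X) U -> nbhs (0 : Y) (q @` U).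

Lemma linear_continuous0 X Y (f : {linear X -> Y}) :
  (forall U, nbhs 0 U -> nbhs 0 (f @^-1` U)) ->
  exists g : linearContinuousType X Y, forall x, g x = f x.
Proof.
move=> f0; have cf : continuous f.
  move=> x U /nbhs_translate0 /f0 fU; apply/nbhs_translate0.
  by apply: filterS fU => v; rewrite /preimage/= raddfD.
pose g : linearContinuousType X Y := HB.pack (GRing.Linear.sort f)
  (GRing.Linear.class f) (isContinuous.Build X Y f cf).
by exists g.
Qed.

Lemma lc_nbhs0 X Y (f : linearContinuousType X Y) U :
  nbhs 0 U -> nbhs 0 (f @^-1` U).
Proof.
move=> U0; have cf : continuous f := @cts_fun _ _ f.
by apply: cf; rewrite (raddf0 f : f 0 = 0).
Qed.

(** Preimages under [k] are unique, hence depend linearly on [z]. Continuity follows because the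
    neighbourhoods of 0 in [X] are induced from [Y], where [t] is continuous. *)
Lemma embedding_lift X Y Z (k : linearContinuousType X Y) (t : linearContinuousType Z Y) :
  embedding k -> (forall z, exists x, k x = t z) ->
  exists u : linearContinuousType Z X, forall z, k (u z) = t z.
Proof.
move=> [k_inj k_emb] /choice[u ku].
have u_lin : linear u.
  by move=> a x y; apply: k_inj; rewrite (linearP k)/= !ku (linearP t).
pose u' : {linear Z -> X} := HB.pack u (GRing.isLinear.Build K Z X *:%R u u_lin).
have [|v vE] := @linear_continuous0 _ _ u'.
  move=> U /k_emb[W W0 WU]; apply: filterS (lc_nbhs0 t W0) => z.
  by rewrite /preimage/= -ku => /WU.
by exists v => z; rewrite vE; exact: ku.
Qed.

(** Composing [t] with a section of [q] is independent of the section, since [t] vanishes where [q]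
    does. The preimage of [U] contains the [q]-image of its preimage under [t], a neighbourhood by
    openness. *)
Lemma open_surjection_factor X Y Z (q : linearContinuousType X Y)
    (t : linearContinuousType X Z) :
  open_surjection q -> (forall x, q x = 0 -> t x = 0) ->
  exists u : linearContinuousType Y Z, forall x, u (q x) = t x.
Proof.
move=> [q_surj q_open] qt; have [s sE] := choice q_surj.
have tq x y : q x = q y -> t x = t y.
  move=> qxy; apply/eqP; rewrite -subr_eq0 -raddfB; apply/eqP/qt.
  by rewrite raddfB/= qxy subrr.
pose u y := t (s y).
have u_lin : linear u.
  by move=> a x y; rewrite /u -(linearP t); apply: tq; rewrite (linearP q)/= !sE.
have uq x : u (q x) = t x by apply: tq; rewrite sE.
pose u' : {linear Y -> Z} := HB.pack u (GRing.isLinear.Build K Y Z *:%R u u_lin).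
have [|v vE] := @linear_continuous0 _ _ u'.
  move=> U /(lc_nbhs0 t)/q_open; apply: filterS => _ [x Ux <-].
  by rewrite /preimage/= uq.
by exists v => x; rewrite vE; exact: uq.
Qed.

End LinearContinuousMaps.

Section ExactCategory.
Variables (K : numFieldType) (I : Type) (T : I -> topologicalLmodType K).
Local Notation C := (linear_continuous_category T).

(** The identity, exposing a morphism as a map that can be applied to points. *)
Definition mor_map (A B : C) (f : mor A B) : linearContinuousType (T A) (T B) := f.
Local Notation "f @@ x" := (mor_map f x) (at level 26, left associativity).

Definition closed_under_kernels := forall (A B : C) (f : {linear T A -> T B}),
  exists (L : C) (k : mor L A), embedding (mor_map k) /\
    forall x, f x = 0 <-> exists z, k @@ z = x.

Definition closed_under_cokernels := forall (A B : C) (f : {linear T A -> T B}),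
  exists (Q : C) (q : mor B Q), open_surjection (mor_map q) /\
    forall y, q @@ y = 0 <-> exists x, f x = y.

Definition closed_under_biproducts := forall (A B : C),
  exists (P : C) (iA : mor A P) (iB : mor B P) (pA : mor P A) (pB : mor P B),
    is_biproduct iA iB pA pB.

Lemma mor_mapP (A B : C) (f g : mor A B) : f = g <-> forall x, f @@ x = g @@ x.
Proof.
split=> [-> //|fg]; apply: linearContinuousP; exact/funext.
Qed.

Lemma mor_map_comp (A B D : C) (g : mor B D) (f : mor A B) x :
  (g ∘ f) @@ x = g @@ (f @@ x).
Proof. by []. Qed.

Lemma mor_map0 (A B : C) x : (0 : mor A B) @@ x = 0.
Proof. by []. Qed.

Lemma mor_mapD (A B : C) (f g : mor A B) x : (f + g) @@ x = f @@ x + g @@ x.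
Proof. by []. Qed.

Lemma mor_map_id (A : C) x : idm A @@ x = x.
Proof. by []. Qed.

Definition mor_mapE := (mor_map_comp, mor_map0, mor_mapD, mor_map_id).

Lemma embedding_is_kernel_of (A B L : C) (f : mor A B) (k : mor L A) :
  embedding (mor_map k) -> (forall x, f @@ x = 0 <-> exists z, k @@ z = x) ->
  is_kernel_of f k.
Proof.
move=> k_emb fk; split.
  by apply/mor_mapP => x; rewrite mor_mapE; apply/fk; exists x.
move=> S t ft.
have [z|u ku] := embedding_lift k_emb (t := mor_map t).
  by apply/fk; move/mor_mapP : ft; exact.
exists u; split; first exact/mor_mapP.
move=> v /mor_mapP kv; apply/mor_mapP => x; apply: k_emb.1.
by rewrite [LHS]ku -kv.
Qed.

Lemma open_surjection_is_cokernel_of (A B Q : C) (f : mor A B) (q : mor B Q) :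
  open_surjection (mor_map q) ->
  (forall y, q @@ y = 0 <-> exists x, f @@ x = y) -> is_cokernel_of f q.
Proof.
move=> q_open fq; split.
  by apply/mor_mapP => x; rewrite mor_mapE; apply/fq; exists x.
move=> S t /mor_mapP tf.
have [y|u uq] := open_surjection_factor q_open (t := mor_map t).
  by move=> /fq[x <-]; exact: tf.
exists u; split; first exact/mor_mapP.
move=> v /mor_mapP vq; apply/mor_mapP => y; have [x <-] := q_open.1 y.
by rewrite [LHS]uq -vq.
Qed.

Section Closed.
Hypotheses (I0 : inhabited I) (hker : closed_under_kernels)
  (hcoker : closed_under_cokernels) (hprod : closed_under_biproducts).

Lemma kernels_exist (A B : C) (f : mor A B) :
  exists (L : C) (k : mor L A), is_kernel_of f k.
Proof.
have [L [k [k_emb kf]]] := hker (mor_map f).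
by exists L, k; exact: embedding_is_kernel_of.
Qed.

Lemma cokernels_exist (A B : C) (f : mor A B) :
  exists (Q : C) (q : mor B Q), is_cokernel_of f q.
Proof.
have [Q [q [q_open qf]]] := hcoker (mor_map f).
by exists Q, q; exact: open_surjection_is_cokernel_of.
Qed.

Lemma zero_object_exists : exists Z : C, is_zero_object Z.
Proof.
(* The zero object is the kernel of an identity morphism. *)
case: I0 => i; have [Z [k [[k_inj _] kE]]] := hker (mor_map (idm (i : C))).
have Z0 x : x = 0 :> T Z.
  by apply: k_inj; rewrite raddf0; apply/kE; exists x.
exists Z => A; split; exists 0; split=> // f _; apply/mor_mapP => x.
  by rewrite (Z0 x) !raddf0.
by rewrite (Z0 (f @@ x)).
Qed.

Lemma closed_pre_abelian : pre_abelian C.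
Proof.
split; [|exact: kernels_exist|exact: cokernels_exist].
by split; [exact: zero_object_exists|exact: hprod].
Qed.

(** * Monomorphisms, epimorphisms, kernels and cokernels as maps *)

(** For a monomorphism [f], the embedding of its null space is killed by [f], hence zero, so the
    null space is trivial. *)
Lemma mono_injective (A B : C) (f : mor A B) :
  monomorphism f <-> injective (mor_map f).
Proof.
split=> [f_mono|f_inj S u v /mor_mapP fuv]; last first.
  by apply/mor_mapP => x; apply: f_inj; exact: fuv.
have [L [k [_ kf]]] := hker (mor_map f).
have /mor_mapP k0 : k = 0.
  by apply: f_mono; apply/mor_mapP => x; rewrite !mor_mapE raddf0; apply/kf; exists x.
move=> x y fxy; apply/eqP; rewrite -subr_eq0; apply/eqP.
have /kf[z <-] : f @@ (x - y) = 0 by rewrite raddfB/= fxy subrr.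
exact: k0.
Qed.

(** The projection modulo the range kills [f], hence is zero if [f] is an epimorphism. The quotient
    is by the range itself, not by its closure, which yields surjectivity and not just density. *)
Lemma epi_surjective (A B : C) (f : mor A B) :
  epimorphism f <-> forall y, exists x, f @@ x = y.
Proof.
split=> [f_epi|f_surj S u v /mor_mapP uvf]; last first.
  by apply/mor_mapP => y; have [x <-] := f_surj y; exact: uvf.
have [Q [q [_ qf]]] := hcoker (mor_map f).
have /mor_mapP q0 : q = 0.
  by apply: f_epi; apply/mor_mapP => x; rewrite !mor_mapE; apply/qf; exists x.
by move=> y; apply/qf; exact: q0.
Qed.

(** Any kernel of [f] is compared with the embedding [j] supplied by [hker]; the universal
    properties make [u] a left inverse of [v], and the embedding property passes from [j] to [k].
    Conversely, an embedding is the kernel of its own cokernel. *)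
Lemma kernel_embedding (L A : C) (k : mor L A) :
  is_kernel k <-> embedding (mor_map k).
Proof.
split=> [[B [f [fk0 kU]]]|k_emb]; last first.
  have [Q [q [q_open qk]]] := hcoker (mor_map k).
  by exists Q, q; exact: embedding_is_kernel_of.
have [L' [j [j_emb jf]]] := hker (mor_map f).
have [fj0 jU] := embedding_is_kernel_of j_emb jf.
have [u [ku _]] := kU _ j fj0; have [v [jv _]] := jU _ k fk0.
have uv : u ∘ v = idm L.
  have [w [_ wE]] := kU _ k fk0.
  by rewrite -(wE (idm L)) ?compm_idr// -(wE (u ∘ v))// compmA ku jv.
have vK : cancel (mor_map v) (mor_map u) by move=> x; move/mor_mapP : uv; exact.
have kE x : k @@ x = j @@ (v @@ x) by rewrite -jv.
split=> [x y|U /(lc_nbhs0 (mor_map u)) /j_emb.2[W W0 WU]].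
  by rewrite !kE => /j_emb.1 /(can_inj vK).
by exists W => // x; rewrite kE => /WU; rewrite /preimage/= vK.
Qed.

(** Dual: openness passes from the constructed quotient [p] to [q], and an open surjection is the
    cokernel of its own kernel. *)
Lemma cokernel_open_surjection (B Q : C) (q : mor B Q) :
  is_cokernel q <-> open_surjection (mor_map q).
Proof.
split=> [[A [f [qf0 qU]]]|q_open]; last first.
  have [L [k [k_emb kq]]] := hker (mor_map q).
  by exists L, k; exact: open_surjection_is_cokernel_of.
have [Q' [p [p_open pf]]] := hcoker (mor_map f).
have [pf0 pU] := open_surjection_is_cokernel_of p_open pf.
have [u [uq _]] := qU _ p pf0; have [v [vp _]] := pU _ q qf0.
have vu : v ∘ u = idm Q.
  have [w [_ wE]] := qU _ q qf0.
  by rewrite -(wE (idm Q)) ?compm_idl// -(wE (v ∘ u))// -compmA uq vp.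
have uK : cancel (mor_map u) (mor_map v) by move=> x; move/mor_mapP : vu; exact.
have qE x : q @@ x = v @@ (p @@ x) by rewrite -vp.
split=> [y|U /p_open.2 /(lc_nbhs0 (mor_map u))].
  by have [x px] := p_open.1 (u @@ y); exists x; rewrite qE px uK.
by apply: filterS => y [x Ux px]; exists x => //; rewrite qE px uK.
Qed.

(** * Pullbacks and pushouts through biproducts *)

(** Each [z] is the sum of its two components re-injected, so continuity of addition and of the
    injections makes [z] small once its components are. Thus any biproduct has the product
    topology. *)
Lemma biproduct_nbhs0 (A B P : C) (iA : mor A P) (iB : mor B P)
    (pA : mor P A) (pB : mor P B) U : is_biproduct iA iB pA pB ->
  nbhs (0 : T P) U -> exists V W, [/\ nbhs (0 : T A) V, nbhs (0 : T B) W &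
    forall z, V (pA @@ z) -> W (pB @@ z) -> U z].
Proof.
move=> [_ _ _ _ /mor_mapP iP] /nbhs0D[U' U'0 U'U].
exists (mor_map iA @^-1` U'), (mor_map iB @^-1` U').
split=> [||z Vz Wz]; [exact: lc_nbhs0|exact: lc_nbhs0|].
by rewrite -[z]mor_map_id -iP; exact: U'U.
Qed.

Lemma biproduct_pair (A B P : C) (iA : mor A P) (iB : mor B P)
    (pA : mor P A) (pB : mor P B) : is_biproduct iA iB pA pB ->
  forall x y, exists z, pA @@ z = x /\ pB @@ z = y.
Proof.
move=> [/mor_mapP pAiA /mor_mapP pBiB /mor_mapP pAiB /mor_mapP pBiA _] x y.
exists (iA @@ x + iB @@ y); rewrite !raddfD/= -!mor_map_comp.
by rewrite pAiA pAiB pBiA pBiB !mor_mapE addr0 add0r.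
Qed.

(* The comparison map from the pullback constructed as [ker (c ∘ pB - d ∘ pC)]. *)
Lemma pullback_lift (A B C' D : C)
    (a : mor A B) (b : mor A C') (c : mor B D) (d : mor C' D) :
  is_pullback a b c d ->
  (forall y z, c @@ y = d @@ z -> exists x, a @@ x = y) /\
  forall U, nbhs (0 : T A) U -> exists V W, [/\ nbhs (0 : T B) V,
    nbhs (0 : T C') W & forall y z, V y -> W z -> c @@ y = d @@ z ->
      exists2 x, U x & a @@ x = y].
Proof.
move=> [_ abU]; have [P [iB [iC [pB [pC bip]]]]] := hprod B C'.
have [L [k [k_emb kE]]] := hker (mor_map (c ∘ pB - d ∘ pC)).
have [|u [[/mor_mapP au _] _]] := abU L (pB ∘ k) (pC ∘ k).
  apply/mor_mapP => x; rewrite !mor_mapE; apply/eqP; rewrite -subr_eq0.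
  by apply/eqP/(kE (k @@ x)); exists x.
(* A compatible pair is a point of [P] killed by [c ∘ pB - d ∘ pC], so it comes from [L], and [u]
   carries it to [A]. *)
have lift y z : c @@ y = d @@ z ->
    exists x, [/\ a @@ (u @@ x) = y, pB @@ (k @@ x) = y & pC @@ (k @@ x) = z].
  move=> cd; have [w [wy wz]] := biproduct_pair bip y z.
  have /kE[x xw] : (c ∘ pB - d ∘ pC) @@ w = 0.
    apply/eqP; rewrite [_ @@ _]/(c @@ (pB @@ w) - d @@ (pC @@ w)) subr_eq0.
    by rewrite wy wz cd.
  by exists x; split; rewrite -1?mor_map_comp ?au ?mor_mapE xw.
split=> [y z /lift[x [ax _ _]]|U U0]; first by exists (u @@ x).
(* Pull [U] back to [L] along [u], extend it to [P] through the embedding, then shrink it to a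
   product neighbourhood. *)
have [G G0 GU] := k_emb.2 _ (lc_nbhs0 (mor_map u) U0).
have [V [W [V0 W0 VW]]] := biproduct_nbhs0 bip G0.
exists V, W; split=> // y z Vy Wz /lift[x [ax xy xz]].
by exists (u @@ x) => //; apply: GU; apply: VW; rewrite ?xy ?xz.
Qed.

(* The comparison map to the pushout constructed as [coker (iB ∘ a - iC ∘ b)]. *)
Lemma pushout_lift (A B C' D : C)
    (a : mor A B) (b : mor A C') (c : mor B D) (d : mor C' D) :
  is_pushout a b c d ->
  (forall z, d @@ z = 0 -> exists2 x, a @@ x = 0 & b @@ x = z) /\
  forall V W, nbhs (0 : T B) V -> nbhs (0 : T C') W ->
    exists2 U, nbhs (0 : T D) U & forall z, U (d @@ z) ->
      exists x w, [/\ V (a @@ x), W w & z = w + b @@ x].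
Proof.
move=> [_ cdU]; have [P [iB [iC [pB [pC bip]]]]] := hprod B C'.
have [/mor_mapP pBiB /mor_mapP pCiC /mor_mapP pBiC /mor_mapP pCiB _] := bip.
have pB1 y : pB @@ (iB @@ y) = y := pBiB y.
have pC1 z : pC @@ (iC @@ z) = z := pCiC z.
have pB0 z : pB @@ (iC @@ z) = 0 := pBiC z.
have pC0 y : pC @@ (iB @@ y) = 0 := pCiB y.
have [Q [q [q_open qE]]] := hcoker (mor_map (iB ∘ a - iC ∘ b)).
have [|u [[_ /mor_mapP ud] _]] := cdU Q (q ∘ iB) (q ∘ iC).
  apply/mor_mapP => x; rewrite !mor_mapE; apply/eqP.
  rewrite -subr_eq0 -(raddfB (mor_map q)).
  by apply/eqP/(qE (iB @@ (a @@ x) - iC @@ (b @@ x))); exists x.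
have sep z p : q @@ (iC @@ z) = q @@ p ->
    exists x, a @@ x = pB @@ p /\ z = pC @@ p + b @@ x.
  move=> /eqP; rewrite -subr_eq0 -(raddfB (mor_map q)) => /eqP/qE[x xE].
  have {}xE : iB @@ (a @@ x) - iC @@ (b @@ x) = iC @@ z - p := xE.
  (* The component of [xE] in [B] reads [a @@ x = - (pB @@ p)], whence the sign. *)
  exists (- x); split.
    have := congr1 (mor_map pB) xE; rewrite !raddfB/= pB1 !pB0 subr0 sub0r.
    by rewrite raddfN/= => ->; rewrite opprK.
  have := congr1 (mor_map pC) xE; rewrite !raddfB/= pC0 !pC1 sub0r raddfN/= => ->.
  by rewrite subrKC.
split=> [z dz|V W V0 W0].
  have [|x [ax zx]] := sep z 0.
    by rewrite -mor_map_comp -ud mor_mapE dz !raddf0.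
  by exists x; rewrite ?ax ?zx raddf0 ?add0r.
(* The product of [V] and [W] is mapped by the open [q] to a neighbourhood of 0 in [Q], then pulled
   back along [u] to [D]. *)
exists (mor_map u @^-1` (mor_map q @` (mor_map pB @^-1` V `&` mor_map pC @^-1` W))).
  apply: lc_nbhs0; apply: q_open.2.
  by apply: filterI; exact: lc_nbhs0.
move=> z [p [Vp Wp] pz]; have [|x [ax zE]] := sep z p.
  by rewrite -mor_map_comp -ud pz.
by exists x, (pC @@ p); rewrite ax.
Qed.

Lemma pullback_surjective (A B C' D : C)
    (a : mor A B) (b : mor A C') (c : mor B D) (d : mor C' D) :
  is_pullback a b c d -> (forall y, exists x, d @@ x = y) ->
  forall y, exists x, a @@ x = y.
Proof.
move=> /pullback_lift[lift _] d_surj y.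
by have [z dz] := d_surj (c @@ y); apply: (lift y z).
Qed.

Lemma pushout_injective (A B C' D : C)
    (a : mor A B) (b : mor A C') (c : mor B D) (d : mor C' D) :
  is_pushout a b c d -> injective (mor_map a) -> injective (mor_map d).
Proof.
move=> /pushout_lift[sep _] a_inj x y dxy; apply/eqP; rewrite -subr_eq0.
have [|w aw <-] := sep (x - y); first by rewrite raddfB/= dxy subrr.
by rewrite (a_inj w 0) ?raddf0// aw raddf0.
Qed.

(** * The stability properties *)

(** For [y] near 0, openness of [d] gives a [z] in [W] with [d @@ z = c @@ y]; the pair then lifts
    to a point of [U]. *)
Lemma cokernel_stable : stable_under_pullback (@is_cokernel C).
Proof.
move=> A B C' D a b c d pb /cokernel_open_surjection d_open.
apply/cokernel_open_surjection; split.
  exact: pullback_surjective pb d_open.1.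
move=> U U0; have [V [W [V0 W0 VW]]] := (pullback_lift pb).2 U U0.
have := lc_nbhs0 (mor_map c) (d_open.2 W W0).
apply: filterS2 V0 => y Vy [z Wz dz].
by have [x Ux <-] := VW y z Vy Wz (esym dz); exists x.
Qed.

(** If [d @@ z] is small then [z = w + b @@ x] with [w] and [a @@ x] small. As [a] is an embedding,
    [b @@ x] is small too, hence so is [z]. *)
Lemma kernel_stable : stable_under_pushout (@is_kernel C).
Proof.
move=> A B C' D a b c d po /kernel_embedding a_emb.
apply/kernel_embedding; split; first exact: pushout_injective po a_emb.1.
move=> U /nbhs0D[W W0 WU].
have [V V0 VW] := a_emb.2 _ (lc_nbhs0 (mor_map b) W0).
have [G G0 GE] := (pushout_lift po).2 V W V0 W0.
exists G => // z /GE[x [w [Vx Ww ->]]].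
by apply: WU => //; exact: VW.
Qed.

Theorem closed_quasi_abelian : quasi_abelian C.
Proof.
by split; (split; first exact: closed_pre_abelian);
  [exact: cokernel_stable|exact: kernel_stable].
Qed.

Theorem closed_integral : integral_category C.
Proof.
split; (split; first exact: closed_pre_abelian) => A B C' D a b c d.
  by move=> pb /epi_surjective ?; apply/epi_surjective; exact: pullback_surjective pb _.
by move=> po /mono_injective ?; apply/mono_injective; exact: pushout_injective po _.
Qed.

End Closed.
End ExactCategory.

(** * Initial and final structures *)

Section InitialFinal.
Variables (K : numFieldType) (I : Type) (T : I -> topologicalLmodType K).
Local Notation C := (linear_continuous_category T).

(* The identity of [V], with its source and target seen as different structures, is
   represented by the mutually inverse maps [e] and [e']. *)
Definition has_initial := forall (A B : I) (V : lmodType K)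
    (f : {linear V -> T A}) (g : {linear V -> T B}),
  exists (Z : I) (e : {linear V -> T Z}) (e' : {linear T Z -> V}),
    [/\ cancel e e', cancel e' e & forall U, nbhs 0 U <->
      exists P Q, [/\ nbhs 0 P, nbhs 0 Q & f @^-1` P `&` g @^-1` Q `<=` e @^-1` U]].

Definition has_final := forall (A : I) (V : lmodType K) (q : {linear T A -> V}),
  (forall z, exists x, q x = z) ->
  exists (Z : I) (e : {linear V -> T Z}) (e' : {linear T Z -> V}),
    [/\ cancel e e', cancel e' e & forall U, nbhs 0 U <->
      nbhs 0 (q @^-1` (e @^-1` U))].

Lemma initial_kernels : has_initial -> closed_under_kernels T.
Proof.
move=> init A B f.
pose V : lmodType K := submodule (linear_kernel_submodClosed f).
pose val : {linear V -> T A} := @submodule_val K (T A) (linear_kernel_submodClosed f).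
(* The subspace structure is the initial one for the inclusion taken twice. *)
have [L [e [e' [eK e'K nbhsL]]]] := init A A V val val.
pose k : {linear T L -> T A} := val \o e'.
have [|k' k'E] := @linear_continuous0 _ _ _ k.
  move=> U U0; apply/nbhsL; exists U, U; split=> // x [Ux _].
  by rewrite /preimage/= eK.
exists L, k'; split; last first.
  move=> x; split=> [fx|[z <-]].
    have kx : x \in linear_kernel_submodClosed f by apply/eqP.
    by exists (e (Submodule kx)); rewrite [LHS]k'E /k/= eK.
  by rewrite [mor_map _ _]k'E; apply/eqP; rewrite /k/=; case: (e' z).
split=> [x y|U /nbhsL[P [Q [P0 Q0 PQ]]]].
  rewrite ![mor_map _ _]k'E => /val_inj/(congr1 e); by rewrite !e'K.
exists (P `&` Q); first exact: filterI.
by move=> x; rewrite [mor_map _ _]k'E => -[Px Qx]; rewrite -[x]e'K; apply: PQ.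
Qed.

Lemma final_cokernels : has_final -> closed_under_cokernels T.
Proof.
move=> final A B f; pose S := linear_range_submodClosed f.
have [Q [e [e' [eK e'K nbhsQ]]]] := final B _ (@quotient_proj _ _ S)
  (@quotient_proj_surj _ _ S).
pose q : {linear T B -> T Q} := e \o @quotient_proj _ _ S.
have [|q' q'E] := @linear_continuous0 _ _ _ q; first by move=> U /nbhsQ.
exists Q, q'; split; last first.
  move=> y; rewrite [mor_map _ _]q'E; split=> [qy|fy].
    have {}qy : e (quotient_proj S y) = 0 := qy.
    by apply/asboolP/(@quotient_proj_eq0 _ _ S); rewrite -[LHS]eK qy raddf0.
  rewrite /q/= (_ : quotient_proj S y = 0) ?raddf0//.
  by apply/quotient_proj_eq0/asboolP.
split=> [z|U U0].
  have [y yE] := quotient_proj_surj (e' z).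
  by exists y; rewrite [LHS]q'E /q/= yE e'K.
by apply/nbhsQ; apply: filterS U0 => y Uy; exists y.
Qed.

Lemma initial_biproducts : has_initial -> closed_under_biproducts T.
Proof.
move=> init A B.
pose V : lmodType K := (T A * T B)%type.
have fst_lin : linear (fun z : V => z.1) by [].
have snd_lin : linear (fun z : V => z.2) by [].
pose f : {linear V -> T A} := HB.pack (fun z : V => z.1)
  (GRing.isLinear.Build K V (T A) *:%R (fun z : V => z.1) fst_lin).
pose g : {linear V -> T B} := HB.pack (fun z : V => z.2)
  (GRing.isLinear.Build K V (T B) *:%R (fun z : V => z.2) snd_lin).
(* Only the vector space [V] is the library product; its structure as an object is the initial one
   for the projections. *)
have [P [e [e' [eK e'K nbhsP]]]] := init A B V f g.
have inA_lin : linear (fun x : T A => (x, 0) : V).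
  by move=> a x y; congr pair; rewrite /= scaler0 addr0.
have inB_lin : linear (fun y : T B => (0, y) : V).
  by move=> a x y; congr pair; rewrite /= scaler0 addr0.
pose inA : {linear T A -> V} := HB.pack (fun x : T A => (x, 0) : V)
  (GRing.isLinear.Build K (T A) V *:%R (fun x : T A => (x, 0) : V) inA_lin).
pose inB : {linear T B -> V} := HB.pack (fun y : T B => (0, y) : V)
  (GRing.isLinear.Build K (T B) V *:%R (fun y : T B => (0, y) : V) inB_lin).
have [|iA iAE] := @linear_continuous0 _ _ _ (e \o inA).
  move=> U /nbhsP[G [H [G0 H0 GH]]]; apply: filterS G0 => x Gx.
  by apply: (GH (x, 0)); split=> //; apply: (nbhs_singleton H0).
have [|iB iBE] := @linear_continuous0 _ _ _ (e \o inB).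
  move=> U /nbhsP[G [H [G0 H0 GH]]]; apply: filterS H0 => y Hy.
  by apply: (GH (0, y)); split=> //; apply: (nbhs_singleton G0).
have [|pA pAE] := @linear_continuous0 _ _ _ (f \o e').
  move=> U U0; apply/nbhsP; exists U, setT; split=> //; first exact: filterT.
  by move=> z [Uz _]; rewrite /preimage/= eK.
have [|pB pBE] := @linear_continuous0 _ _ _ (g \o e').
  move=> U U0; apply/nbhsP; exists setT, U; split=> //; first exact: filterT.
  by move=> z [_ Uz]; rewrite /preimage/= eK.
exists P, iA, iB, pA, pB.
split; apply/mor_mapP => x; rewrite !mor_mapE.
- by rewrite [LHS]pAE [mor_map _ _]iAE /= eK.
- by rewrite [LHS]pBE [mor_map _ _]iBE /= eK.
- by rewrite [LHS]pAE [mor_map _ _]iBE /= eK.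
- by rewrite [LHS]pBE [mor_map _ _]iAE /= eK.
- rewrite [mor_map iA _]iAE [mor_map iB _]iBE [mor_map pA _]pAE [mor_map pB _]pBE /=.
  rewrite -raddfD -[RHS]e'K; congr (e _); case: (e' x) => y z.
  by congr pair; rewrite /= ?addr0 ?add0r.
Qed.

Lemma initial_final_quasi_abelian_integral :
  inhabited I -> has_initial -> has_final -> quasi_abelian C /\ integral_category C.
Proof.
move=> I0 init final.
have hker := initial_kernels init; have hcoker := final_cokernels final.
have hprod := initial_biproducts init.
by split; [exact: closed_quasi_abelian|exact: closed_integral].
Qed.

End InitialFinal.

(** * Topological vector spaces and locally convex spaces *)

Section ConvexSets.
Variables (K : numFieldType) (V W : lmodType K) (f : {linear V -> W}).

Lemma linear_conv (l : {i01 K}) (x y : convex_lmodType V) :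
  f (conv l x y : V) = conv l (f x : convex_lmodType W) (f y).
Proof.
rewrite /conv/= raddfD/=.
by rewrite !(linearZZ f).
Qed.

Lemma convex_preimage (A : set W) : convex_set A -> convex_set (f @^-1` A).
Proof.
move=> cA x y l /set_mem xA /set_mem yA; apply/mem_set.
rewrite /preimage/= linear_conv; apply/set_mem.
by apply: cA; exact/mem_set.
Qed.

Lemma convex_image (A : set V) : convex_set A -> convex_set (f @` A).
Proof.
move=> cA _ _ l /set_mem[x xA <-] /set_mem[y yA <-]; apply/mem_set.
exists (conv l (x : convex_lmodType V) y); last exact: linear_conv.
by apply/set_mem; apply: cA; exact/mem_set.
Qed.

Lemma convex_setI (A B : set V) :
  convex_set A -> convex_set B -> convex_set (A `&` B).
Proof.
move=> cA cB x y l /set_mem[xA xB] /set_mem[yA yB]; apply/mem_set.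
by split; apply/set_mem; [apply: cA|apply: cB]; exact/mem_set.
Qed.

End ConvexSets.

Section ZeroFilterIdentity.
Variables (K : numFieldType) (V : lmodType K) (F : zero_filter V).

Definition to_zero_filter_space (x : V) : zero_filter_space F := x.
Definition of_zero_filter_space (x : zero_filter_space F) : V := x.

Lemma to_zero_filter_space_linear : linear to_zero_filter_space.
Proof. by []. Qed.
Lemma of_zero_filter_space_linear : linear of_zero_filter_space.
Proof. by []. Qed.
HB.instance Definition _ := GRing.isLinear.Build K V (zero_filter_space F) *:%R
  to_zero_filter_space to_zero_filter_space_linear.
HB.instance Definition _ := GRing.isLinear.Build K (zero_filter_space F) V *:%R
  of_zero_filter_space of_zero_filter_space_linear.

End ZeroFilterIdentity.

Section TopologicalVectorSpaces.
Variable K : numFieldType.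

Lemma TVS_quasi_abelian_integral :
  quasi_abelian (TVS K) /\ integral_category (TVS K).
Proof.
apply: initial_final_quasi_abelian_integral.
- exact: (inhabits (zero_filter_space (indiscrete_filter K^o) : topologicalLmodType K)).
- move=> X Y V f g; exists (zero_filter_space (initial_filter f g)).
  exists (@to_zero_filter_space _ _ _), (@of_zero_filter_space _ _ _); split=> // U.
  exact: zero_filter_nbhs0.
- move=> X V q q_surj; exists (zero_filter_space (final_filter q_surj)).
  exists (@to_zero_filter_space _ _ _), (@of_zero_filter_space _ _ _); split=> // U.
  exact: zero_filter_nbhs0.
Qed.

Lemma indiscrete_locally_convex (V : lmodType K) :
  locally_convex_at0 (zero_filter_space (indiscrete_filter V)).
Proof.
move=> U /zero_filter_nbhs0 UT; exists U; split=> //.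
  exact/zero_filter_nbhs0.
by move=> x y l _ _; apply/mem_set; rewrite UT.
Qed.

Lemma initial_locally_convex (X Y : topologicalLmodType K) (V : lmodType K)
    (f : {linear V -> X}) (g : {linear V -> Y}) :
  locally_convex_at0 X -> locally_convex_at0 Y ->
  locally_convex_at0 (zero_filter_space (initial_filter f g)).
Proof.
move=> cX cY U /zero_filter_nbhs0[A [B [/cX[A' [A'0 cA AA]] /cY[B' [B'0 cB BB]] AB]]].
exists (f @^-1` A' `&` g @^-1` B'); split.
- by apply/zero_filter_nbhs0; exists A', B'; split.
- exact: (convex_setI (convex_preimage (f := f) cA) (convex_preimage (f := g) cB)).
- by move=> x [/AA Ax /BB Bx]; apply: AB.
Qed.

Lemma final_locally_convex (X : topologicalLmodType K) (V : lmodType K)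
    (q : {linear X -> V}) (q_surj : forall z, exists x, q x = z) :
  locally_convex_at0 X ->
  locally_convex_at0 (zero_filter_space (final_filter q_surj)).
Proof.
move=> cX U /zero_filter_nbhs0 /cX[A [A0 cA AU]].
exists (q @` A); split.
- by apply/zero_filter_nbhs0; apply: filterS A0 => x Ax; exists x.
- exact: (convex_image (f := q) cA).
- by move=> _ [x /AU Ux <-].
Qed.

Lemma LCS_quasi_abelian_integral :
  quasi_abelian (LCS K) /\ integral_category (LCS K).
Proof.
apply: initial_final_quasi_abelian_integral.
- exact: (inhabits (Lcs (@indiscrete_locally_convex K^o))).
- move=> [X cX] [Y cY] V f g; exists (Lcs (initial_locally_convex (f := f) (g := g) cX cY)).
  exists (@to_zero_filter_space _ _ _), (@of_zero_filter_space _ _ _); split=> // U.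
  exact: zero_filter_nbhs0.
- move=> [X cX] V q q_surj; exists (Lcs (final_locally_convex (q_surj := q_surj) cX)).
  exists (@to_zero_filter_space _ _ _), (@of_zero_filter_space _ _ _); split=> // U.
  exact: zero_filter_nbhs0.
Qed.

End TopologicalVectorSpaces.

(** * Semi-normed spaces *)

Section Infima.

(** The form of completeness behind the infimum semi-norm. Restricting to nonnegative elements lets
    it hold for the partial order of the complex numbers. *)
Definition has_nonneg_infima (K : numFieldType) := forall A : set K,
  A !=set0 -> (forall a, A a -> 0 <= a) -> exists m, [/\ 0 <= m,
    forall a, A a -> m <= a & forall e, 0 < e -> exists2 a, A a & a < m + e].

Lemma real_has_nonneg_infima (R : realType) : has_nonneg_infima R.
Proof.
move=> A A0 A_ge0; have infA : has_inf A by split=> //; exists 0 => a /A_ge0.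
exists (inf A); split=> [|a Aa|e e0]; first exact: lb_le_inf.
  by apply: ge_inf => //; exact: infA.2.
by have [a Aa ae] := inf_adherent e0 infA; exists a.
Qed.

(** Nonnegative complex numbers are real, so the infimum is taken among the reals and embedded
    back. *)
Lemma complex_has_nonneg_infima (R : realType) : has_nonneg_infima R[i]%C.
Proof.
move=> A [a0 Aa0] A_ge0; pose B := [set x : R | A (x%:C)%C].
have Are a : A a -> a = (complex.Re a)%:C%C.
  by move=> /A_ge0; case: a => x y; rewrite lecE/= => /andP[/eqP-> _].
have [||m [m0 mB mE]] := @real_has_nonneg_infima R B.
- by exists (complex.Re a0); rewrite /B/= -Are.
- by move=> x /A_ge0; rewrite lecR.
exists m%:C%C; split=> [|a Aa|[e ei]]; first by rewrite lecR.
  by rewrite (Are _ Aa) lecR; apply: mB; rewrite /B/= -Are.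
rewrite ltcE/= => /andP[/eqP-> /mE[x Bx xm]].
by exists x%:C%C => //; rewrite ltcE/= addr0 eqxx.
Qed.

End Infima.

Section SemiNormedSpaces.
Variable K : numFieldType.

Section Identity.
Variable V : semiNormedSpace K.

Definition to_seminorm_topology (x : V) : seminorm_topology V := x.
Definition of_seminorm_topology (x : seminorm_topology V) : V := x.

Lemma to_seminorm_topology_linear : linear to_seminorm_topology.
Proof. by []. Qed.
Lemma of_seminorm_topology_linear : linear of_seminorm_topology.
Proof. by []. Qed.
HB.instance Definition _ := GRing.isLinear.Build K V (seminorm_topology V) *:%R
  to_seminorm_topology to_seminorm_topology_linear.
HB.instance Definition _ := GRing.isLinear.Build K (seminorm_topology V) V *:%R
  of_seminorm_topology of_seminorm_topology_linear.

Lemma seminorm_nbhs0 (U : set (seminorm_topology V)) :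
  nbhs (0 : seminorm_topology V) U <->
  exists2 e : K, 0 < e & forall y, seminorm (of_seminorm_topology y) < e -> U y.
Proof.
split=> [/seminorm_nbhsP[e e0 eU]|[e e0 eU]].
  by exists e => // y ye; apply: eU; rewrite sub0r normrN.
by apply/seminorm_nbhsP; exists e => // y; rewrite sub0r normrN; exact: eU.
Qed.

End Identity.

Definition zero_seminorm_space : semiNormedSpace K.
Proof.
refine (@SemiNormedSpace K K^o (fun=> 0) _ _ _) => [//|x y|a x].
- by rewrite addr0.
- by rewrite mulr0.
Defined.

(** The sum of the pulled-back semi-norms induces the initial topology and avoids a maximum in the
    partially ordered [K]. *)
Definition initial_seminorm_space (A B : semiNormedSpace K) (V : lmodType K)
    (f : {linear V -> seminorm_topology A}) (g : {linear V -> seminorm_topology B}) :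
  semiNormedSpace K.
Proof.
refine (@SemiNormedSpace K V (fun x => `|f x| + `|g x|) _ _ _) => [x|x y|a x].
- by rewrite addr_ge0.
- by rewrite !raddfD/= addrACA lerD// ler_normD.
- by rewrite !linearZ/= !seminorm_normrZ mulrDr.
Defined.

Lemma initial_seminorm_nbhs0 (A B : semiNormedSpace K) (V : lmodType K)
    (f : {linear V -> seminorm_topology A}) (g : {linear V -> seminorm_topology B})
    (U : set V) :
  nbhs (0 : seminorm_topology (initial_seminorm_space f g)) U <->
  exists P Q, [/\ nbhs 0 P, nbhs 0 Q & f @^-1` P `&` g @^-1` Q `<=` U].
Proof.
split=> [/seminorm_nbhs0[e e0 eU]|[P [Q]]].
  have h : 0 < e / 2 by rewrite divr_gt0.
  exists [set x | `|x| < e / 2], [set y | `|y| < e / 2]; split.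
  - by apply/seminorm_nbhs0; exists (e / 2).
  - by apply/seminorm_nbhs0; exists (e / 2).
  - by move=> x [fx gx]; apply: eU; rewrite [ltRHS]splitr; exact: ltrD.
move=> [/seminorm_nbhs0[e e0 eP] /seminorm_nbhs0[d d0 dQ] PQ].
have ed : (e >=< d)%R by apply: real_comparable; exact: gtr0_real.
apply/seminorm_nbhs0; exists (Num.min e d); first by rewrite /Num.min; case: ifP.
move=> x; rewrite comparable_lt_min// => /andP[xe xd]; apply: PQ; split.
- by apply: eP; apply: le_lt_trans xe; rewrite lerDl.
- by apply: dQ; apply: le_lt_trans xd; rewrite lerDr.
Qed.

Section Quotient.
Hypothesis infK : has_nonneg_infima K.
Variables (A : semiNormedSpace K) (V : lmodType K).
Variable q : {linear seminorm_topology A -> V}.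
Hypothesis q_surj : forall z, exists x, q x = z.

(** The value [p z] is the infimum of the semi-norms over the fibre of [z], nonempty by
    surjectivity. *)
Lemma quotient_seminorm_exists : exists p : V -> K,
  [/\ forall z, 0 <= p z, forall x, p (q x) <= `|x| &
    forall z e, 0 < e -> exists2 x, q x = z & `|x| < p z + e].
Proof.
have inf z : exists m, [/\ 0 <= m, forall x, q x = z -> m <= `|x| &
    forall e, 0 < e -> exists2 x, q x = z & `|x| < m + e].
  have [||m [m0 mle mlt]] := infK (A := [set `|x| | x in [set x | q x = z]]).
  - by have [x qx] := q_surj z; exists `|x|, x.
  - by move=> _ [x _ <-].
  exists m; split=> // [x qx|e /mlt[_ [x qx <-] xe]]; last by exists x.
  by apply: mle; exists x.
have [p pE] := choice inf; exists p.
split=> [z|x|z]; first by have [] := pE z.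
  by have [_ + _] := pE (q x); exact.
by have [] := pE z.
Qed.

Lemma quotient_seminorm_space : exists p : V -> K, [/\ forall z, 0 <= p z,
  forall z w, p (z + w) <= p z + p w, forall a z, p (a *: z) = `|a| * p z,
  forall x, p (q x) <= `|x| &
  forall z e, p z < e -> exists2 x, q x = z & `|x| < e].
Proof.
have [p [p0 p_le p_lt]] := quotient_seminorm_exists.
have pZ a z : p (a *: z) <= `|a| * p z.
  apply/ler_addgt0Pr => e e0.
  (* The summand 1 keeps the divisor positive when [a = 0]; the error term then stays below [e]. *)
  have a1 : 0 < `|a| + 1 by rewrite ltr_wpDl.
  have [x <- xe] := p_lt z (e / (`|a| + 1)) (divr_gt0 e0 a1).
  rewrite -linearZ/= (le_trans (p_le _))// seminorm_normrZ.
  rewrite (le_trans (ler_wpM2l _ (ltW xe)))// mulrDr lerD2l.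
  by rewrite mulrCA ler_piMr ?(ltW e0)// ler_pdivrMr// mul1r lerDl.
exists p; split=> // [z w|a z|z e ze].
- apply/ler_addgt0Pr => e e0; have h : 0 < e / 2 by rewrite divr_gt0.
  have [x <- xe] := p_lt z _ h; have [y <- ye] := p_lt w _ h.
  rewrite -raddfD (le_trans (p_le _))// (le_trans (ler_normD _ _))//.
  by rewrite (splitr e) addrACA lerD// ltW.
(* The reverse inequality is [pZ] for the inverse of [a]. *)
- apply/eqP; rewrite eq_le pZ/=; have [->|a0] := eqVneq a 0.
    by rewrite normr0 mul0r.
  have a_gt0 : 0 < `|a| by rewrite normr_gt0.
  rewrite mulrC -ler_pdivlMr// mulrC -normfV.
  by rewrite -[leLHS](congr1 p (scalerK a0 z)).
- have [|x qx xe] := p_lt z (e - p z); first by rewrite subr_gt0.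
  by exists x => //; rewrite subrKC in xe.
Qed.

End Quotient.

Lemma SNOR_quasi_abelian_integral : has_nonneg_infima K ->
  quasi_abelian (SNOR K) /\ integral_category (SNOR K).
Proof.
move=> infK; apply: initial_final_quasi_abelian_integral.
- exact: (inhabits zero_seminorm_space).
- move=> A B V f g; pose S := initial_seminorm_space f g.
  pose e : {linear S -> seminorm_topology S} := @to_seminorm_topology S.
  pose e' : {linear seminorm_topology S -> S} := @of_seminorm_topology S.
  exists S, e, e'; split=> // U.
  exact: initial_seminorm_nbhs0.
- move=> A V q q_surj.
  have [p [p0 pD pZ pq p_lt]] := quotient_seminorm_space infK q_surj.
  pose S := SemiNormedSpace p0 pD pZ.
  pose e : {linear S -> seminorm_topology S} := @to_seminorm_topology S.
  pose e' : {linear seminorm_topology S -> S} := @of_seminorm_topology S.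
  exists S, e, e'; split=> // U.
  (* The open ball of radius [r] for [p] is the [q]-image of the open ball of radius [r]: [pq] gives
     one inclusion and [p_lt] the other. *)
  split=> [/seminorm_nbhs0[r r0 rU]|/seminorm_nbhs0[r r0 rU]].
    apply/seminorm_nbhs0; exists r => // x xe; apply: rU.
    exact: le_lt_trans (pq x) xe.
  apply/seminorm_nbhs0; exists r => // z /p_lt[x qx xr].
  by have := rU x xr; rewrite /preimage/= qx.
Qed.

End SemiNormedSpaces.

Theorem theorem3p1 (R : realType) (k : numFieldType)
    (hk : k = R :> numFieldType \/ k = R[i]%C :> numFieldType) :
  [/\ quasi_abelian (SNOR k) /\ integral_category (SNOR k),
      quasi_abelian (LCS k) /\ integral_category (LCS k) &
      quasi_abelian (TVS k) /\ integral_category (TVS k)].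
Proof.
split; [|exact: LCS_quasi_abelian_integral|exact: TVS_quasi_abelian_integral].
apply: SNOR_quasi_abelian_integral.
by case: hk => ->; [exact: real_has_nonneg_infima|exact: complex_has_nonneg_infima].
Qed.
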